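(* Let $X$ be a real vector space and let $M,N:X\to X$ be mutually polar retractions with ranges $\mathbf M=MX$ and $\mathbf N=NX$. Suppose that the convex cones $\mathbf M$ and $\mathbf N$ are generating and $\sigma$-monotone complete, and that $M$ is $\sigma$-monotone continuous with respect to $\leq_M$ and $N$ is $\sigma$-monotone continuous with respect to $\leq_N$. If $M$ is subadditive with respect to $\leq_M$ and $N$ is subadditive with respect to $\leq_N$, then: (a) $\mathbf M$ and $\mathbf N$ are lattice cones, and $(X,\mathbf M)$ and $(X,\mathbf N)$ are $\sigma$-monotone complete Riesz spaces; (b) $M$ and $-N$ are, respectively, the positive part mapping and the negative part mapping of $(X,\mathbf M)$; (c) $N$ and $-M$ are, respectively, the positive part mapping and the negative part mapping of $(X,\mathbf N)$.
   Context: Let $X$ be a real vector space. A nonempty set $\mathbf K\subset X$ is a convex cone if $\lambda x\in\mathbf K$ for all $x\in\mathbf K$, $\lambda\in[0,\infty)$, and $x+y\in\mathbf K$ for all $x,y\in\mathbf K$. It is pointed if $\mathbf K\cap(-\mathbf K)=\{0\}$ and generating if $\mathbf K-\mathbf K=X$. The relation induced by $\mathbf K$ is: $x\leq y$ if and only if $y-x\in\mathbf K$; when $\mathbf K$ is pointed this is an order relation and $(X,\mathbf K)$ is called an ordered vector space. Mutually polar retractions: mappings $M,N:X\to X$ (not assumed linear) such that (i) $\mathbf M:=MX$ and $\mathbf N:=NX$ are convex cones; (ii) $Mx+Nx=x$ for all $x\in X$; (iii) $M(Nx)=N(Mx)=0$ for all $x\in X$. The relations induced by $\mathbf M$ and $\mathbf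 N$ are denoted $\leq_M$ and $\leq_N$. A mapping $R:X\to X$ is subadditive with respect to $\leq$ if $R(x+y)\leq Rx+Ry$ for all $x,y\in X$. A convex cone $\mathbf K$ is called $\sigma$-monotone complete if it is pointed and $(X,\mathbf K)$ is a $\sigma$-monotone complete ordered vector space, i.e. every increasing sequence in $X$ that is bounded from above (for the order induced by $\mathbf K$) has a supremum in $X$. A mapping $T:X\to X$ is $\sigma$-monotone continuous with respect to an order $\leq$ if for every increasing sequence $\{a_n\}_{n=1}^\infty$ in $X$ having a supremum $a$, the sequence $\{Ta_n\}_{n=1}^\infty$ is increasing and has supremum $Ta$. $(X,\mathbf K)$ is a Riesz space, and $\mathbf K$ is a lattice cone, if $\mathbf K$ is pointed and every two elements $x,y\in X$ have a supremum $x\vee y$ in the order induced by $\mathbf K$. In a Riesz space, the positive part mapping is $x\mapsto x^+=0\vee x$ and the negative part mapping is $x\mapsto x^-=0\vee(-x)$. *)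

(* Defs.v *)
From mathcomp Require Import all_boot all_order all_algebra.
From mathcomp Require Import boolp classical_sets reals.

Set Implicit Arguments.
Unset Strict Implicit.
Unset Printing Implicit Defensive.

Import Order.TTheory GRing.Theory Num.Theory.

Local Open Scope classical_set_scope.
Local Open Scope ring_scope.

Definition convex_cone (R : realType) (X : lmodType R) (K : set X) : Prop :=
  [/\ K !=set0,
      forall (l : R) (x : X), 0 <= l -> K x -> K (l *: x) &
      forall x y : X, K x -> K y -> K (x + y)].

Definition pointed_cone (R : realType) (X : lmodType R) (K : set X) : Prop :=
  K `&` [set - x | x in K] = [set 0].

Definition generating_cone (R : realType) (X : lmodType R) (K : set X) : Prop :=
  [set x - y | x in K & y in K] = [set: X].

(* Several cones on the same [X] are used at once, so the induced relation is a
   plain relation indexed by the cone rather than a canonical porder on [X]. *)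
Definition cone_le (R : realType) (X : lmodType R) (K : set X) (x y : X) : Prop :=
  K (y - x).

Definition is_ordered_vector_space (R : realType) (X : lmodType R) (K : set X)
  : Prop := convex_cone K /\ pointed_cone K.

Definition cone_ub (R : realType) (X : lmodType R) (K A : set X) (b : X) : Prop :=
  forall x, A x -> cone_le K x b.

Definition cone_sup (R : realType) (X : lmodType R) (K A : set X) (s : X) : Prop :=
  cone_ub K A s /\ forall b, cone_ub K A b -> cone_le K s b.

(* "Increasing" is meant in the weak sense. *)
Definition cone_increasing (R : realType) (X : lmodType R) (K : set X)
    (a : nat -> X) : Prop :=
  forall m n : nat, (m <= n)%N -> cone_le K (a m) (a n).

Definition sigma_monotone_complete (R : realType) (X : lmodType R) (K : set X)
  : Prop :=
  is_ordered_vector_space K /\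
  forall a : nat -> X, cone_increasing K a ->
    (exists b, cone_ub K (range a) b) -> exists s, cone_sup K (range a) s.

Definition sigma_monotone_continuous (R : realType) (X : lmodType R) (K : set X)
    (T : X -> X) : Prop :=
  forall (a : nat -> X) (s : X),
    cone_increasing K a -> cone_sup K (range a) s ->
    cone_increasing K (T \o a) /\ cone_sup K (range (T \o a)) (T s).

Definition cone_subadditive (R : realType) (X : lmodType R) (K : set X)
    (T : X -> X) : Prop :=
  forall x y : X, cone_le K (T (x + y)) (T x + T y).

Definition lattice_cone (R : realType) (X : lmodType R) (K : set X) : Prop :=
  is_ordered_vector_space K /\
  forall x y : X, exists s, cone_sup K [set x; y] s.

Definition sigma_monotone_complete_riesz (R : realType) (X : lmodType R)
    (K : set X) : Prop := lattice_cone K /\ sigma_monotone_complete K.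

Definition is_positive_part (R : realType) (X : lmodType R) (K : set X)
    (P : X -> X) : Prop := forall x : X, cone_sup K [set 0; x] (P x).

Definition is_negative_part (R : realType) (X : lmodType R) (K : set X)
    (P : X -> X) : Prop := forall x : X, cone_sup K [set 0; - x] (P x).

Definition mutually_polar (R : realType) (X : lmodType R) (M N : X -> X) : Prop :=
  [/\ convex_cone (range M) /\ convex_cone (range N),
      forall x : X, M x + N x = x &
      forall x : X, M (N x) = 0 /\ N (M x) = 0].

(* Main.v *)
Require Import Defs.
From mathcomp Require Import all_boot all_order all_algebra.
From mathcomp Require Import boolp classical_sets reals.
Import GRing.Theory.
Local Open Scope classical_set_scope.
Local Open Scope ring_scope.

(** Monotonicity of [M] gives [M (- m) <= M 0 = 0] for [m] in the cone [M X], so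
    [M (- m) = 0] by pointedness, that is, [- m] lies in [N X].  By symmetry
    [N X = - M X].  Hence [M x - x = - N x] lies in [M X], so [M x] is an upper
    bound of [0] and [x]; any other upper bound [b] is fixed by [M], so
    [M x <= M b = b]. *)

Lemma cone_sup2P (R : realType) (X : lmodType R) (K : set X) (x y s : X) :
  cone_sup K [set x; y] s <->
  [/\ cone_le K x s, cone_le K y s &
      forall b, cone_le K x b -> cone_le K y b -> cone_le K s b].
Proof.
split=> [[ub lub]|[xs ys lub]].
- split=> [||b xb yb]; [by apply: ub; left | by apply: ub; right |].
  by apply: lub => z [->|->].
- split=> [z [->|->] //|b ub].
  by apply: lub; apply: ub; [left | right].
Qed.

(** The cone order depends only on differences, so a translation is an order automorphism. This lets
    suprema of arbitrary pairs be reduced to suprema of pairs containing [0]. *)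
Lemma cone_sup2_translate (R : realType) (X : lmodType R) (K : set X)
    (x y s z : X) :
  cone_sup K [set x; y] s -> cone_sup K [set x + z; y + z] (s + z).
Proof.
have shift u v : cone_le K (u + z) v = cone_le K u (v - z).
  by rewrite /cone_le opprD addrA addrAC.
move=> /cone_sup2P[xs ys lub]; apply/cone_sup2P.
rewrite !shift addrK; split=> // b; rewrite !shift.
exact: lub.
Qed.

Lemma convex_cone0 (R : realType) (X : lmodType R) (K : set X) :
  convex_cone K -> K 0.
Proof. by case=> -[x Kx] KZ _; rewrite -(scale0r x); apply: KZ. Qed.

Lemma pointed_cone_eq0 (R : realType) (X : lmodType R) (K : set X) (x : X) :
  pointed_cone K -> K x -> K (- x) -> x = 0.
Proof.
move=> pK Kx KNx; suff: (K `&` [set - y | y in K]) x by rewrite pK.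
by split=> //; exists (- x) => //; rewrite opprK.
Qed.

Lemma sigma_monotone_continuous_homo (R : realType) (X : lmodType R)
    (K : set X) (T : X -> X) (x y : X) :
  convex_cone K -> sigma_monotone_continuous K T ->
  cone_le K x y -> cone_le K (T x) (T y).
Proof.
move=> /convex_cone0 K0 contT xy.
(* The sequence [x, y, y, ...] is increasing with supremum [y]; the image sequence being increasing
   at indices 0 and 1 is exactly [T x <= T y]. *)
pose a n := if n is 0%N then x else y.
have incr_a : cone_increasing K a.
  by move=> [|m] [|n] //= _; rewrite /cone_le subrr.
have sup_a : cone_sup K (range a) y.
  split=> [_ [[|n] _ <-]|b]; [exact: xy | by rewrite /cone_le subrr |].
  by apply; exists 1%N.
by have [incr_Ta _] := contT a y incr_a sup_a; apply: (incr_Ta 0%N 1%N).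
Qed.

Lemma mutually_polarC (R : realType) (X : lmodType R) (M N : X -> X) :
  mutually_polar M N -> mutually_polar N M.
Proof.
case=> -[cM cN] MDN MN0; split=> // x; first by rewrite addrC.
by have [] := MN0 x.
Qed.

(** If [x = M y], then [N x = N (M y) = 0], so the decomposition [M x + N x = x] reduces to its
    first term. *)
Lemma mutually_polar_id (R : realType) (X : lmodType R) (M N : X -> X) (x : X) :
  mutually_polar M N -> range M x -> M x = x.
Proof.
move=> [_ MDN MN0] [y _ <-].
by rewrite -[RHS]MDN (MN0 y).2 addr0.
Qed.

Lemma range_polar_opp (R : realType) (X : lmodType R) (M N : X -> X) (x : X) :
  mutually_polar M N -> pointed_cone (range M) ->
  sigma_monotone_continuous (range M) M ->
  range M x -> range N (- x).
Proof.
move=> hMN pM contM Mx; have [[cM _] MDN _] := hMN.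
(* A convex cone contains [0], and [M] fixes every point of its range. *)
have M0 : M 0 = 0 by apply: mutually_polar_id hMN _; exact: convex_cone0.
have : cone_le (range M) (M (- x)) (M 0).
  by apply: sigma_monotone_continuous_homo => //; rewrite /cone_le sub0r opprK.
rewrite /cone_le M0 sub0r => MNMx.
have MNx0 : M (- x) = 0 by apply: pointed_cone_eq0 MNMx => //; exists (- x).
by exists (- x) => //; rewrite -[RHS]MDN MNx0 add0r.
Qed.

Lemma polar_positive_part (R : realType) (X : lmodType R) (M N : X -> X) :
  mutually_polar M N -> pointed_cone (range N) ->
  sigma_monotone_continuous (range M) M ->
  sigma_monotone_continuous (range N) N ->
  is_positive_part (range M) M.
Proof.
move=> hMN pN contM contN x; have [[cM _] MDN _] := hMN.
apply/cone_sup2P; split=> [||b]; rewrite /cone_le ?subr0.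
- by exists x.
- have -> : M x - x = - N x by rewrite -[X in _ - X]MDN opprD addNKr.
  (* The roles are swapped here: [N x] lies in the range of [N], so monotonicity of [N] and
     pointedness of its range place [- N x] in the range of [M]. *)
  by apply: range_polar_opp (mutually_polarC _ _ _ _ hMN) pN contN _; exists x.
- move=> Mb xb; rewrite -(mutually_polar_id _ _ _ _ _ hMN Mb).
  exact: (sigma_monotone_continuous_homo _ _ _ M x b cM contM xb).
Qed.

(** Translating the supremum [P x] of [0] and [x] by [- x] gives the supremum of [- x] and [0],
    which is [P x - x = - Q x]. *)
Lemma positive_part_negative_part (R : realType) (X : lmodType R) (K : set X)
    (P Q : X -> X) :
  (forall x, P x + Q x = x) ->
  is_positive_part K P -> is_negative_part K (fun x => - Q x).
Proof.
move=> PDQ posP x; have := cone_sup2_translate _ _ _ _ _ _ (- x) (posP x).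
by rewrite add0r subrr -[X in P x - X]PDQ opprD addNKr setUC.
Qed.

(** This is the Riesz space identity that the supremum of [x] and [y] equals the positive part of
    [y - x], translated by [x]. *)
Lemma positive_part_lattice_cone (R : realType) (X : lmodType R) (K : set X)
    (P : X -> X) :
  is_ordered_vector_space K -> is_positive_part K P -> lattice_cone K.
Proof.
move=> ovK posP; split=> // x y; exists (P (y - x) + x).
by have := cone_sup2_translate _ _ _ _ _ _ x (posP (y - x)); rewrite add0r subrK.
Qed.

Theorem theorem1 (R : realType) (X : lmodType R) (M N : X -> X)
  (hMN : mutually_polar M N)
  (genM : generating_cone (range M))
  (genN : generating_cone (range N))
  (complM : sigma_monotone_complete (range M))
  (complN : sigma_monotone_complete (range N))
  (contM : sigma_monotone_continuous (range M) M)
  (contN : sigma_monotone_continuous (range N) N)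
  (subM : cone_subadditive (range M) M)
  (subN : cone_subadditive (range N) N) :
  [/\ [/\ lattice_cone (range M), lattice_cone (range N),
          sigma_monotone_complete_riesz (range M) &
          sigma_monotone_complete_riesz (range N)],
      is_positive_part (range M) M /\
        is_negative_part (range M) (fun x => - N x) &
      is_positive_part (range N) N /\
        is_negative_part (range N) (fun x => - M x)].
Proof.
have [ovM _] := complM; have [ovN _] := complN.
have hNM := mutually_polarC _ _ _ _ hMN.
have [_ MDN _] := hMN; have [_ NDM _] := hNM.
(* Pointedness crosses over: the positive part for one cone uses pointedness of the other. *)
have posM := polar_positive_part _ _ _ _ hMN ovN.2 contM contN.
have posN := polar_positive_part _ _ _ _ hNM ovM.2 contN contM.
have latM := positive_part_lattice_cone _ _ _ _ ovM posM.
have latN := positive_part_lattice_cone _ _ _ _ ovN posN.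
by split; split=> //; exact: positive_part_negative_part.
Qed.
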